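(* Let $\vartheta$ be a random substitution of constant length $\ell\ge 2$ over a finite alphabet $\mathcal{A}$ (not necessarily primitive). Then, for every permissible letter frequency vector $\nu=(\nu_a)_{a\in\mathcal{A}}$ for $\vartheta$, $$h_{\mathrm{top}}(X_\vartheta)\ \ge\ \frac{1}{\ell}\sum_{a\in\mathcal{A}}\nu_a\log(\#\vartheta(a)).$$ Moreover, there exists a permissible letter frequency vector $\eta=(\eta_a)_{a\in\mathcal{A}}$ for $\vartheta$ such that $$h_{\mathrm{top}}(X_\vartheta)\ \le\ \frac{1}{\ell-1}\sum_{a\in\mathcal{A}}\eta_a\log(\#\vartheta(a)).$$ In particular, $\eta$ can be taken to be any permissible letter frequency vector that maximises the quantity $\sum_{a\in\mathcal{A}}\eta_a\log(\#\vartheta(a))$ among permissible letter frequency vectors.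
   Context: Let $\mathcal{A}$ be a finite alphabet, $\mathcal{A}^+$ the set of non-empty finite words over $\mathcal{A}$; $|u|$ is the length of $u$ and $|u|_a$ the number of occurrences of the letter $a$ in $u$. A random substitution over $\mathcal{A}$ is a map $\vartheta$ assigning to each letter $a\in\mathcal{A}$ a non-empty finite set $\vartheta(a)\subset\mathcal{A}^+$ of realisations (together with a choice of strictly positive probabilities on each $\vartheta(a)$, which plays no role here and is ignored). It is of constant length $\ell\ge2$ if $|v|=\ell$ for all $a\in\mathcal{A}$ and $v\in\vartheta(a)$. For a word $u=u_1\cdots u_n$, $\vartheta(u)=\{w_1\cdots w_n : w_i\in\vartheta(u_i)\}$; powers are defined by $\vartheta^1=\vartheta$ and $\vartheta^k(a)=\bigcup_{v\in\vartheta^{k-1}(a)}\vartheta(v)$. A word is $\vartheta$-legal if it is a (contiguous) subword of some word in $\vartheta^k(a)$ for some $k\in\mathbb{N}$, $a\in\mathcal{A}$; $\mathcal{L}_\vartheta$ is the set of legal words. The subshift of $\vartheta$ is $X_\vartheta=\{w\in\mathcal{A}^{\mathbb{Z}} : \text{every finite subword of } w \text{ lies in } \mathcal{L}_\vartheta\}$ with the left shift. $\mathcal{L}(X_\vartheta)$ is the set of finite words occurring in elements of $X_\vartheta$. A vector $\nu=(\nu_a)_{a\in\mathcal{A}}\in[0,1]^{\#\mathcal{A}}$ is a permissible letter frequency vector for $\vartheta$ if there exist a letter $b\in\mathcal{A}\cap\mathcal{L}(X_\vartheta)$, a sequence of positive integers $(n_k)_k$ with $n_k\to\infty$, and words $v^k\in\vartheta^{n_k}(b)$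 such that $|v^k|_a/|v^k|\to\nu_a$ as $k\to\infty$ for all $a\in\mathcal{A}$. $p_X(n)$ is the number of distinct words of length $n$ occurring in elements of $X$, and $h_{\mathrm{top}}(X)=\lim_{n\to\infty}\frac1n\log p_X(n)$. *)

(* Defs.v *)
From HB Require Import structures.
From mathcomp Require Import all_boot all_order all_algebra.
From mathcomp Require Import finmap.
From mathcomp Require Import all_classical all_reals all_analysis.
Set Implicit Arguments.
Unset Strict Implicit.
Unset Printing Implicit Defensive.
Import Order.TTheory GRing.Theory Num.Theory.
Import numFieldNormedType.Exports.
Local Open Scope classical_set_scope.
Local Open Scope ring_scope.

(* The probabilities attached to the realisations are omitted: neither the
   subshift nor the letter frequency vectors depend on them. *)
Record random_subst (A : finType) := RandomSubst {
  realisations :> A -> {fset seq A};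
  realisations_neq0 : forall a, realisations a != fset0;
  realisations_nil : forall a, [::] \notin realisations a
}.

Definition constant_length (A : finType) (theta : random_subst A) (l : nat) :=
  forall (a : A) (v : seq A), v \in theta a -> size v = l.

(* [all2] also forces [ws] and [u] to have the same size. *)
Definition subst_word (A : finType) (theta : random_subst A) (u : seq A) :
    set (seq A) :=
  [set flatten ws | ws in
    [set ws : seq (seq A) | all2 (fun w a => w \in theta a) ws u]].

(* The recursion starts from the convention theta^0(a) = {a}; by
   [subst_pow1], theta^1 = theta. *)
Fixpoint subst_pow (A : finType) (theta : random_subst A) (k : nat) (a : A) :
    set (seq A) :=
  if k is k'.+1 then \bigcup_(v in subst_pow theta k' a) subst_word theta v
  else [set [:: a]].

Lemma subst_pow1 (A : finType) (theta : random_subst A) (a : A) :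
  subst_pow theta 1 a = [set v | v \in theta a].
Proof.
apply/seteqP; split => v /=.
- move=> [_ -> [[|w [|w' ws]] //= + <-]]; last by rewrite andbF.
  by rewrite andbT cats0.
- move=> va; exists [:: a] => //; exists [:: v]; first by rewrite /= va.
  by rewrite /= cats0.
Qed.

Definition legal (A : finType) (theta : random_subst A) : set (seq A) :=
  [set u | exists (k : nat) (a : A) (v : seq A),
     [/\ (0 < k)%N, subst_pow theta k a v & infix u v]].

Definition window (A : finType) (w : int -> A) (i : int) (n : nat) : seq A :=
  mkseq (fun j => w (i + j%:Z)) n.

Definition subshift (A : finType) (theta : random_subst A) : set (int -> A) :=
  [set w | forall (i : int) (n : nat), legal theta (window w i n)].

Definition language (A : finType) (X : set (int -> A)) : set (seq A) :=
  [set u | exists2 w, X w & exists i : int, window w i (size u) = u].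

Definition complexity (A : finType) (X : set (int -> A)) (n : nat) : nat :=
  #|[set u : n.-tuple A | `[< language X u >]]%SET|.

Definition htop (R : realType) (A : finType) (X : set (int -> A)) : R :=
  limn (fun n : nat => n%:R^-1 * ln (complexity X n)%:R : R).

Definition permissible (R : realType) (A : finType) (theta : random_subst A)
    (nu : A -> R) : Prop :=
  (forall a, 0 <= nu a <= 1) /\
  exists (b : A) (n : nat -> nat) (v : nat -> seq A),
    [/\ language (subshift theta) [:: b],
        (forall k, (0 < n k)%N) /\ n k @[k --> \oo] --> \oo,
        forall k, subst_pow theta (n k) b (v k)
      & forall a, ((count_mem a (v k))%:R / (size (v k))%:R : R)
                    @[k --> \oo] --> nu a].

(* Main.v *)
(* A word occurs in the subshift exactly when it is extendable: it sits inside
   legal words with arbitrarily long margins on both sides (Koenig's lemma).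
   Extendability is preserved by the substitution, so a word v of theta^n(b)
   with b in the language yields prod_i #theta(v_i) words of length l^(n+1) in
   the language, whence the lower bound. Conversely, by compactness, a word of
   the language of length N l^m is a factor of a realisation under theta^m of a
   word of length N + 1 of the language, so that
     h l^m <= log #A + max_b log #theta^m(b) <= log #A + sum_(k < m) W_k,
   where W_k is the largest value of sum_i log #theta(v_i) over v in theta^k(b)
   with b in the language. As W_k / l^k is nonincreasing, its limit is attained by
   the limit frequencies of any convergent subsequence of maximisers, and summing
   the geometric series gives the factor 1 / (l - 1). *)
Require Import Defs.
From mathcomp Require Import all_boot all_order all_algebra.
From mathcomp Require Import finmap.
From mathcomp Require Import all_classical all_reals all_analysis.
From mathcomp Require Import zify lra ring.
Import Order.TTheory GRing.Theory Num.Theory.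
Import numFieldNormedType.Exports.
Local Open Scope ring_scope.

(** * Lists of realisations of words and of iterates *)

(** Keeping [f] arbitrary lets the same lemmas serve one substitution step and, with [f] an iterate
    [powers f m], several steps at once. *)
Fixpoint substs {T : eqType} (f : T -> seq (seq T)) (u : seq T) : seq (seq T) :=
  if u is a :: u' then [seq w ++ r | w <- f a, r <- substs f u'] else [:: [::]].

(** A word is listed once for each chain of choices leading to it, so [size] only bounds the number
    of distinct words from above, as the upper entropy bound requires. *)
Fixpoint powers {T : eqType} (f : T -> seq (seq T)) (k : nat) (a : T) :
    seq (seq T) :=
  if k is k'.+1 then flatten [seq substs f v | v <- powers f k' a]
  else [:: [:: a]].

Lemma substs_catP {T : eqType} (f : T -> seq (seq T)) (u1 u2 x : seq T) :
  reflect (exists x1 x2, [/\ x1 \in substs f u1, x2 \in substs f u2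
                           & x = x1 ++ x2])
          (x \in substs f (u1 ++ u2)).
Proof.
elim: u1 x => [|a u1 IH] x /=.
  apply: (iffP idP) => [xu2|[x1 [x2 []]]]; last by rewrite inE => /eqP -> ? ->.
  by exists [::], x; rewrite inE.
apply: (iffP (allpairsP)) => [[[w r] /= [wa /IH]]|].
  move=> [x1 [x2 [x1u x2u ->]] ->]; exists (w ++ x1), x2; split=> //.
    by apply/allpairsP; exists (w, x1).
  by rewrite catA.
move=> [x1 [x2 [/allpairsP[[w r] /= [wa ru ->]] x2u ->]]].
exists (w, r ++ x2); split=> //=; last by rewrite catA.
by apply/IH; exists r, x2.
Qed.

Lemma substs_cat {T : eqType} (f : T -> seq (seq T)) (u1 u2 x1 x2 : seq T) :
  x1 \in substs f u1 -> x2 \in substs f u2 -> x1 ++ x2 \in substs f (u1 ++ u2).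
Proof. by move=> h1 h2; apply/substs_catP; exists x1, x2. Qed.

Lemma substs_consP {T : eqType} (f : T -> seq (seq T)) (a : T) (u x : seq T) :
  reflect (exists w r, [/\ w \in f a, r \in substs f u & x = w ++ r])
          (x \in substs f (a :: u)).
Proof.
apply: (iffP (allpairsP)) => [[[w r] [? ? ->]]|[w [r [? ? ->]]]].
  by exists w, r.
by exists (w, r).
Qed.

Lemma substs_letter {T : eqType} (f : T -> seq (seq T)) (a : T) (x : seq T) :
  (x \in substs f [:: a]) = (x \in f a).
Proof.
apply/substs_consP/idP => [[w [r [wa + ->]]]|xa].
  by rewrite inE => /eqP ->; rewrite cats0.
by exists x, [::]; rewrite inE cats0.
Qed.

Lemma substs_neq0 {T : eqType} (f : T -> seq (seq T)) (u : seq T) :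
  (forall a, exists w, w \in f a) -> exists x, x \in substs f u.
Proof.
move=> f0; elim: u => [|a u [x xu]]; first by exists [::]; rewrite inE.
by have [w wa] := f0 a; exists (w ++ x); apply/substs_consP; exists w, x.
Qed.

Lemma size_substs {T : eqType} (f : T -> seq (seq T)) (u : seq T) :
  size (substs f u) = (\prod_(a <- u) size (f a))%N.
Proof.
by elim: u => [|a u IH] /=; rewrite ?big_nil // big_cons size_allpairs IH.
Qed.

Lemma size_substs_word {T : eqType} (f : T -> seq (seq T)) (L : nat)
    (fL : forall a w, w \in f a -> size w = L) (u x : seq T) :
  x \in substs f u -> size x = (size u * L)%N.
Proof.
elim: u x => [|a u IH] x; first by rewrite inE => /eqP ->.
by move/substs_consP => [w [r [/fL wL /IH rL ->]]]; rewrite size_cat wL rL mulSn.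
Qed.

(* With realisations of a common length the factorisation of a concatenation
   is unique, so no word is listed twice. *)
Lemma uniq_substs {T : eqType} (f : T -> seq (seq T)) (L : nat)
    (fL : forall a w, w \in f a -> size w = L) (u : seq T) :
  (forall a, uniq (f a)) -> uniq (substs f u).
Proof.
move=> fu; elim: u => [|a u IH] //=.
apply: allpairs_uniq => //.
move=> p q; rewrite /in_mem/= => /allpairsP[[w r] [/= wa _ ->]].
move=> /allpairsP[[w' r'] [/= wa' _ ->]] /= /eqP.
by rewrite eqseq_cat ?(fL _ _ wa) ?(fL _ _ wa')// => /andP[/eqP -> /eqP ->].
Qed.

Lemma substs_powers0 {T : eqType} (f : T -> seq (seq T)) (u : seq T) :
  substs (powers f 0) u = [:: u].
Proof. by elim: u => //= a u ->. Qed.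

Lemma powersSP {T : eqType} (f : T -> seq (seq T)) k (a : T) (x : seq T) :
  reflect (exists2 v, v \in powers f k a & x \in substs f v)
          (x \in powers f k.+1 a).
Proof. exact: flatten_mapP. Qed.

Lemma substs_powersSP {T : eqType} (f : T -> seq (seq T)) k (u x : seq T) :
  (exists2 v, v \in substs (powers f k) u & x \in substs f v) <->
  x \in substs (powers f k.+1) u.
Proof.
elim: u x => [|a u IH] x.
  split=> [[v]|xu]; first by rewrite inE => /eqP ->.
  by exists [::]; first exact: mem_head.
split=> [[v /substs_consP[w [r [wa ru ->]]] /substs_catP[x1 [x2 [h1 h2 ->]]]]|].
  apply/substs_consP; exists x1, x2; split=> //; first by apply/powersSP; exists w.
  by apply/IH; exists r.
move/substs_consP => [x1 [x2 [/powersSP[w wa h1] /IH[r ru h2] ->]]].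
exists (w ++ r); last exact: substs_cat.
by apply/substs_consP; exists w, r.
Qed.

(** Splits an iterate after its first [k] steps: this serves to desubstitute through the last [m]
    levels and, with [k = 1], to compare consecutive maximal weights. *)
Lemma powers_addP {T : eqType} (f : T -> seq (seq T)) m k (a : T) (x : seq T) :
  (exists2 z, z \in powers f k a & x \in substs (powers f m) z) <->
  x \in powers f (m + k) a.
Proof.
elim: m x => [|m IH] x.
  rewrite add0n; split=> [[z za]|xa].
    by rewrite substs_powers0 inE => /eqP ->.
  by exists x; rewrite // substs_powers0 inE.
rewrite addSn; split=> [[z za /substs_powersSP[v vz xv]]|].
  by apply/powersSP; exists v => //; apply/IH; exists z.
move=> /powersSP[v /IH[z za vz] xv]; exists z => //.
by apply/substs_powersSP; exists v.
Qed.

Lemma size_powers_word {T : eqType} (f : T -> seq (seq T)) (l : nat)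
    (fl : forall a w, w \in f a -> size w = l) k (a : T) (x : seq T) :
  x \in powers f k a -> size x = (l ^ k)%N.
Proof.
elim: k x => [|k IH] x; first by rewrite inE => /eqP ->.
by move=> /powersSP[v /IH vk /(size_substs_word _ _ fl) ->]; rewrite vk expnSr.
Qed.

Lemma powers_neq0 {T : eqType} (f : T -> seq (seq T)) k (a : T) :
  (forall a, exists w, w \in f a) -> exists x, x \in powers f k a.
Proof.
move=> f0; elim: k => [|k [v va]]; first by exists [:: a]; rewrite inE.
have [x xv] := substs_neq0 f v f0.
by exists x; apply/powersSP; exists v.
Qed.

(* A factor of length [N * L] meets at most [N + 1] consecutive blocks. *)
Lemma substs_factor {T : eqType} (f : T -> seq (seq T)) (L N M : nat)
    (z xl u xr : seq T) :
  (0 < L)%N -> (forall a w, w \in f a -> size w = L) ->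
  xl ++ u ++ xr \in substs f z -> size u = (N * L)%N ->
  ((M.+1 * L)%N <= size xl)%N -> ((M.+1 * L)%N <= size xr)%N ->
  exists zl v zr y j, [/\ z = zl ++ v ++ zr, size v = N.+1,
    (M <= size zl)%N /\ (M <= size zr)%N, y \in substs f v
    & (j < L)%N /\ u = take (N * L) (drop j y)].
Proof.
move=> L0 fL xz uN hl hr.
have sz := size_substs_word f L fL _ _ xz.
rewrite !size_cat uN in sz.
(* [i] blocks end before [u] starts, and [j] is the offset of [u] inside the next block. *)
pose i := (size xl %/ L)%N; pose j := (size xl %% L)%N.
have xlE : size xl = (i * L + j)%N by rewrite -divn_eq.
have jL : (j < L)%N by rewrite ltn_mod.
have Mi : (M < i)%N by rewrite /i leq_divRL.
(* One of the [M.+1] blocks of margin on the right pays for the additional letter of [v]; [M] of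
   them remain. *)
have iz : (i + N.+1 + M <= size z)%N.
  have : ((i + N + M.+1) * L <= size z * L)%N by rewrite -sz xlE; lia.
  by rewrite leq_mul2r; case/orP => [/eqP|]; lia.
have zE : z = take i z ++ take N.+1 (drop i z) ++ drop (i + N.+1) z.
  by rewrite addnC -drop_drop cat_take_drop cat_take_drop.
have sv : size (take N.+1 (drop i z)) = N.+1.
  by rewrite size_takel// size_drop; lia.
have szl : size (take i z) = i by rewrite size_takel//; lia.
move: xz; rewrite {1}zE => /substs_catP[x1 [y' [x1z /substs_catP[y [x3 [yv _ ->]]]]]].
have sx1 := size_substs_word f L fL _ _ x1z; rewrite szl in sx1.
have sy := size_substs_word f L fL _ _ yv; rewrite sv in sy.
move=> E; exists (take i z), (take N.+1 (drop i z)), (drop (i + N.+1) z), y, j.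
split=> //.
  by rewrite szl size_drop; split; lia.
split=> //.
have : take (N * L) (drop (size xl) (xl ++ u ++ xr)) =
       take (N * L) (drop (size xl) (x1 ++ y ++ x3)) by rewrite E.
rewrite drop_size_cat// -uN take_size_cat// => {1}->.
rewrite drop_cat ifN; last by rewrite xlE sx1; lia.
rewrite xlE sx1 addKn drop_cat ifT; last by rewrite sy; lia.
by rewrite takel_cat// size_drop sy uN; lia.
Qed.

(** * The random substitution and its legal words *)

Definition images {A : finType} (theta : random_subst A) (a : A) :
  seq (seq A) := enum_fset (theta a).

Lemma images_neq0 {A : finType} (theta : random_subst A) (a : A) :
  exists w, w \in images theta a.
Proof. by have /fset0Pn[w wa] := realisations_neq0 theta a; exists w. Qed.

Lemma subst_wordE {A : finType} (theta : random_subst A) (u v : seq A) :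
  subst_word theta u v <-> v \in substs (images theta) u.
Proof.
elim: u v => [|a u IH] v.
  split=> [[[|w ws] //= _ <-]|]; first by rewrite inE.
  by rewrite inE => /eqP ->; exists [::].
split=> [[[|w ws] //= /andP[wa wsu] <-]|/substs_consP[w [r [wa /IH[ws wsu <-] ->]]]].
  by apply/substs_consP; exists w, (flatten ws); split=> //; apply/IH; exists ws.
by exists (w :: ws) => //=; apply/andP.
Qed.

Lemma subst_powE {A : finType} (theta : random_subst A) k (a : A) (v : seq A) :
  subst_pow theta k a v <-> v \in powers (images theta) k a.
Proof.
elim: k v => [|k IH] v /=; first by rewrite inE; split=> [->|/eqP].
split=> [[z /IH za /subst_wordE vz]|/flatten_mapP[z /IH za vz]].
  by apply/flatten_mapP; exists z.
by exists z => //; apply/subst_wordE.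
Qed.

Lemma constant_lengthE {A : finType} {theta : random_subst A} {l : nat} :
  constant_length theta l -> forall a w, w \in images theta a -> size w = l.
Proof. by move=> h a w wa; apply: (h a). Qed.

Lemma legal_infix {A : finType} (theta : random_subst A) (u v : seq A) :
  infix u v -> legal theta v -> legal theta u.
Proof.
by move=> uv [k [a [w [k0 wa vw]]]]; exists k, a, w; split=> //; apply: infix_trans vw.
Qed.

(** Substituting also the prefix and suffix around [u] puts [v] inside a realisation of level
    [m + k]. *)
Lemma legal_substs {A : finType} (theta : random_subst A) m (u v : seq A) :
  legal theta u -> v \in substs (powers (images theta) m) u -> legal theta v.
Proof.
move=> [k [a [w [k0 /subst_powE wa /infixP[p [q wE]]]]]] vu.
have im0 b := powers_neq0 (images theta) m b (images_neq0 theta).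
have [p' pp'] := substs_neq0 _ p im0.
have [q' qq'] := substs_neq0 _ q im0.
exists (m + k)%N, a, (p' ++ v ++ q'); split.
- by rewrite addn_gt0 k0 orbT.
- apply/subst_powE/powers_addP; exists w => //.
  by rewrite wE; apply: substs_cat => //; apply: substs_cat.
- by apply/infixP; exists p', q'.
Qed.

(** Realisations of level at most [m] have length at most [l ^ m], so [u] comes from a level
    [k > m]. The strict inequality keeps [k - m] positive, which makes [z] legal. *)
Lemma legal_desubst {A : finType} {theta : random_subst A} {l m : nat}
    (hl : (2 <= l)%N) (htheta : constant_length theta l) (u : seq A) :
  legal theta u -> (l ^ m < size u)%N ->
  exists z v, [/\ legal theta z, v \in substs (powers (images theta) m) z
                & infix u v].
Proof.
move=> [k [a [v [k0 /subst_powE va uv]]]] lu.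
have vk := size_powers_word _ _ (constant_lengthE htheta) _ _ _ va.
have mk : (m < k)%N.
  rewrite -(ltn_exp2l m k hl) -vk; apply: leq_trans lu _.
  exact: size_infix.
move: va; rewrite -(subnKC (ltnW mk)) => /powers_addP[z za vz].
exists z, v; split=> //; exists (k - m)%N, a, z; split; first by rewrite subn_gt0.
  exact/subst_powE.
exact: infix_refl.
Qed.

(** * Extendable words and the language of the subshift *)

(** The contexts for different [n] need not be compatible; compatibility is recovered later by a
    pigeonhole argument. *)
Definition extendable {A : finType} (theta : random_subst A) (u : seq A) :=
  forall n, exists x y, [/\ (n <= size x)%N, (n <= size y)%N
                          & legal theta (x ++ u ++ y)].

Lemma extendable_legal {A : finType} (theta : random_subst A) (u : seq A) :
  extendable theta u -> legal theta u.
Proof.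
move=> /(_ 0%N)[x [y [_ _]]]; apply: legal_infix.
by apply/infixP; exists x, y.
Qed.

Lemma extendable_infix {A : finType} (theta : random_subst A) (u v : seq A) :
  infix u v -> extendable theta v -> extendable theta u.
Proof.
move=> /infixP[p [q ->]] h n; have [x [y [nx ny xy]]] := h n.
exists (x ++ p), (q ++ y); split.
- by rewrite size_cat; lia.
- by rewrite size_cat; lia.
- by move: xy; rewrite !catA.
Qed.

Lemma extendable_letter {A : finType} (theta : random_subst A) (u : seq A) a :
  extendable theta u -> a \in u -> extendable theta [:: a].
Proof.
move=> uext au; apply: extendable_infix uext.
by case/splitPr: au => p q; apply/infixP; exists p, q.
Qed.

(** Compactness in finite form: if every [t] failed at some stage [g t], none would survive at the
    largest of these stages. *)
Lemma pigeonhole_antitone {T : finType} (P : nat -> T -> Prop) :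
  (forall m n t, (m <= n)%N -> P n t -> P m t) ->
  (forall n, exists t, P n t) -> exists t, forall n, P n t.
Proof.
move=> Pmon Pex; apply: contrapT => h.
have /choice[g gP] : forall t, exists n, ~ P n t.
  by move=> t; apply/existsNP => ?; apply: h; exists t.
have [t Pt] := Pex (\max_t g t)%N.
by apply: (gP t); apply: Pmon Pt; apply: (leq_bigmax t).
Qed.

(** Margins of length [n.+1] supply a pair of adjacent letters with margins [n]; among the finitely
    many pairs, one works for all [n]. *)
Lemma extendable_grow {A : finType} (theta : random_subst A) (u : seq A) :
  extendable theta u -> exists p : A * A, extendable theta (p.1 :: rcons u p.2).
Proof.
move=> uext.
have [|n|p pP] := @pigeonhole_antitone (A * A)%type
  (fun n p => exists x y, [/\ (n <= size x)%N, (n <= size y)%N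
    & legal theta (x ++ (p.1 :: rcons u p.2) ++ y)]).
- move=> m n t mn [x [y [nx ny xy]]]; exists x, y; split=> //.
  + exact: leq_trans nx.
  + exact: leq_trans ny.
- have [x [y [nx ny]]] := uext n.+1.
  case/lastP: x nx => // x a; rewrite size_rcons ltnS => nx.
  case: y ny => // b y; rewrite /= ltnS => ny xy.
  exists (a, b), x, y; split=> //.
  by move: xy; rewrite -cats1 -!catA /= -cats1 -catA.
- by exists p.
Qed.

Lemma powers_of_legal {A : finType} (theta : random_subst A) k (a : A) v :
  (0 < k)%N -> v \in powers (images theta) k a -> legal theta v.
Proof.
by move=> k0 va; exists k, a, v; split=> //; [exact/subst_powE|exact: infix_refl].
Qed.

(** A realisation of level [n.+1] has length at least [2n], hence can be cut with [n] letters on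
    each side. This starts the construction of extendable words of every length. *)
Lemma extendable_nil {A : finType} {theta : random_subst A} {l : nat}
    (hl : (2 <= l)%N) (htheta : constant_length theta l) :
  (0 < #|A|)%N -> extendable theta [::].
Proof.
case/card_gt0P => a _ n.
have [v va] := powers_neq0 (images theta) n.+1 a (images_neq0 theta).
have vs := size_powers_word _ _ (constant_lengthE htheta) _ _ _ va.
have nv : (n.*2 <= size v)%N.
  by rewrite vs expnS -mul2n leq_mul//; apply: ltnW; apply: ltn_expl.
exists (take n v), (drop n v); split.
- by rewrite size_takel//; move: nv => /= nv; lia.
- by rewrite size_drop; move: nv => /= nv; lia.
- by rewrite cat_take_drop; apply: powers_of_legal va.
Qed.

Lemma extendable_size {A : finType} {theta : random_subst A} {l : nat}
    (hl : (2 <= l)%N) (htheta : constant_length theta l) (n : nat) :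
  (0 < #|A|)%N -> exists2 u, size u = n & extendable theta u.
Proof.
move=> A0; elim: n => [|n [u un /extendable_grow[p pu]]].
  by exists [::] => //; apply: extendable_nil htheta A0.
exists (p.1 :: u); first by rewrite /= un.
by apply: extendable_infix pu; apply/infixP; exists [::], [:: p.2]; rewrite /= cats1.
Qed.

Lemma extendable_substs {A : finType} {theta : random_subst A} {l m : nat}
    (hl : (2 <= l)%N) (htheta : constant_length theta l) (u v : seq A) :
  extendable theta u -> v \in substs (powers (images theta) m) u ->
  extendable theta v.
Proof.
move=> uext vu n; have [x [y [nx ny xy]]] := uext n.
have im0 b := powers_neq0 (images theta) m b (images_neq0 theta).
have sz := size_substs_word _ _
  (size_powers_word _ _ (constant_lengthE htheta) m).
have lm : (0 < l ^ m)%N by rewrite expn_gt0; lia.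
have [x' xx'] := substs_neq0 _ x im0; have [y' yy'] := substs_neq0 _ y im0.
exists x', y'; split.
- by rewrite (sz _ _ xx'); apply: leq_trans nx _; apply: leq_pmulr.
- by rewrite (sz _ _ yy'); apply: leq_trans ny _; apply: leq_pmulr.
- apply: (legal_substs _ m _ _ xy).
  by apply: substs_cat => //; apply: substs_cat.
Qed.

(** For each [M], desubstituting a long context of [u] gives an ancestor of [N.+1] letters with
    margins [M]. There are finitely many candidates, so a single ancestor serves for all [M]. *)
Lemma extendable_desubst {A : finType} {theta : random_subst A} {l : nat}
    (m N : nat) (hl : (2 <= l)%N) (htheta : constant_length theta l)
    (u : seq A) :
  extendable theta u -> size u = (N * l ^ m)%N ->
  exists v y j, [/\ size v = N.+1, extendable theta v,
    y \in substs (powers (images theta) m) v, (j < l ^ m)%N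
    & u = take (N * l ^ m) (drop j y)].
Proof.
move=> uext uN; have lm : (0 < l ^ m)%N by rewrite expn_gt0; lia.
pose P M (t : N.+1.-tuple A) :=
  (exists x y, [/\ (M <= size x)%N, (M <= size y)%N & legal theta (x ++ t ++ y)])
  /\ exists y j, [/\ y \in substs (powers (images theta) m) t, (j < l ^ m)%N
    & u = take (N * l ^ m) (drop j y)].
have [||t tP] := @pigeonhole_antitone _ P.
- move=> M M' t MM' [[x [y [nx ny xy]]] ?]; split=> //; exists x, y; split=> //.
  + exact: leq_trans nx.
  + exact: leq_trans ny.
(* [M.+2] blocks cover the [M.+1] that [substs_factor] asks for, and already make the word strictly
   longer than [l ^ m]. *)
- move=> M; have [x [y [nx ny xy]]] := uext (M.+2 * l ^ m)%N.
  have lx : (l ^ m < size (x ++ u ++ y))%N.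
    by rewrite size_cat; move: nx; rewrite !mulSn; lia.
  have [z [w [zl wz /infixP[p [q wE]]]]] := legal_desubst hl htheta _ xy lx.
  have := wz; rewrite wE.
  rewrite (_ : p ++ _ ++ q = (p ++ x) ++ u ++ (y ++ q)); last by rewrite !catA.
  move/substs_factor => /(_ _ N M lm (size_powers_word _ _ (constant_lengthE htheta) m) uN).
  case=> [||zl' [v [zr [y' [j [zE vN [hzl hzr] yv [jl uE]]]]]]].
  + by rewrite size_cat; move: nx; rewrite !mulSn; rewrite /=; lia.
  + by rewrite size_cat; move: ny; rewrite !mulSn; rewrite /=; lia.
  have /eqP vN' := vN; exists (Tuple vN'); split; last by exists y', j.
  by exists zl', zr; split=> //; rewrite -zE.
exists t; have [_ [y [j [yt jl uE]]]] := tP 0%N.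
exists y, j; split=> //; first by rewrite size_tuple.
by move=> M; have [] := tP M.
Qed.

Lemma window_cat {A : finType} (w : int -> A) i m n :
  window w i (m + n) = window w i m ++ window w (i + m%:Z) n.
Proof.
rewrite /window /mkseq iotaD map_cat add0n -[in iota m n](addn0 m) iotaDl -map_comp.
congr (_ ++ _); apply: eq_map => j /=; congr w; lia.
Qed.

(** For the converse direction, growing [u] by one letter on each side again and again gives nested
    extendable words, whose union is a point of the subshift. *)
Lemma language_extendable {A : finType} (theta : random_subst A) (u : seq A) :
  language (subshift theta) u <-> extendable theta u.
Proof.
split=> [[w wX [i uE]] n|uext].
  exists (window w (i - n%:Z) n), (window w (i + (size u)%:Z) n).
  rewrite !size_mkseq; split=> //.
  suff : legal theta (window w (i - n%:Z) n ++
      window w i (size u) ++ window w (i + (size u)%:Z) n) by rewrite uE.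
  rewrite -window_cat -{2}(subrK n%:Z i) -window_cat; exact: wX.
have grow (v : {v | extendable theta v}) :
    {p : A * A | extendable theta (p.1 :: rcons (sval v) p.2)}.
  exact: cid (extendable_grow _ _ (svalP v)).
pose s := fix s k : {v | extendable theta v} := if k is k'.+1 then
  exist (extendable theta) _ (svalP (grow (s k')))
  else exist (extendable theta) u uext.
have sS k : exists a b, sval (s k.+1) = a :: rcons (sval (s k)) b.
  by exists (sval (grow (s k))).1, (sval (grow (s k))).2.
have sz k : size (sval (s k)) = (size u + k.*2)%N.
  elim: k => [|k IH]; first by rewrite addn0.
  by have [a [b ->]] := sS k; rewrite /= size_rcons IH; lia.
(* A default for [nth], taken from a growth step because [u] may be empty. *)
pose a0 := (sval (grow (s 0%N))).1.
have nthS k d j : (j < size (sval (s k)))%N ->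
    nth a0 (sval (s (k + d)%N)) (j + d) = nth a0 (sval (s k)) j.
  move=> jk; elim: d => [|d IH]; first by rewrite !addn0.
  rewrite !addnS; have [a [b ->]] := sS (k + d)%N.
  by rewrite /= nth_rcons ifT ?IH//; move: jk; rewrite !sz; lia.
(* Index [k] of [s k] is the origin, where [u] begins, so coordinate [i] is read at index [k + i].
   With [k] equal to the absolute value of [i] plus one, this index is nonnegative and inside
   [s k]. *)
pose w (i : int) := nth a0 (sval (s (`|i|%N.+1))) ((absz ((`|i|%N.+1)%:Z + i)%R)).
have wE i k : (`|i|%N < k)%N -> w i = nth a0 (sval (s k)) (absz (k%:Z + i)%R).
  move=> ik; rewrite /w -(subnKC ik) -(nthS _ (k - `|i|.+1)%N); last by rewrite sz; lia.
  by congr (nth _ _ _); lia.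
have winE i n k : (`|i|%N + n < k)%N ->
    window w i n = take n (drop (absz (k%:Z + i)%R) (sval (s k))).
  move=> ik; apply: (@eq_from_nth _ a0).
    by rewrite size_mkseq size_takel// size_drop sz; lia.
  rewrite size_mkseq => j jn; rewrite nth_mkseq// nth_take// nth_drop.
  by rewrite (wE _ k); [congr (nth _ _ _)|]; lia.
exists w; last first.
  exists 0; rewrite (winE _ _ (size u).+1)// addr0 absz_nat.
  apply: (@eq_from_nth _ a0); first by rewrite size_takel// size_drop sz; lia.
  move=> j; rewrite size_takel; last by rewrite size_drop sz; lia.
  by move=> ju; rewrite nth_take// nth_drop addnC -[X in s X]add0n (nthS 0%N).
move=> i n; rewrite (winE _ _ (`|i|%N + n).+1)//.
apply: legal_infix (extendable_legal _ _ (svalP (s (`|i|%N + n).+1))).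
set v := sval _; set p := absz _.
by apply/infixP; exists (take p v), (drop n (drop p v)); rewrite !cat_take_drop.
Qed.

(** * Counting the words of the language *)

Lemma complexity_le {A : finType} (theta : random_subst A) n (s : seq (seq A)) :
  (forall u, size u = n -> extendable theta u -> u \in s) ->
  (complexity (subshift theta) n <= size s)%N.
Proof.
move=> h; rewrite /complexity cardE -(size_map val); apply: uniq_leq_size.
  by rewrite map_inj_uniq ?enum_uniq//; apply: val_inj.
move=> _ /mapP[t + ->]; rewrite mem_enum inE => /asboolP /language_extendable.
by apply: h; rewrite size_tuple.
Qed.

Lemma complexity_ge {A : finType} (theta : random_subst A) n (s : seq (seq A)) :
  uniq s -> (forall u, u \in s -> size u = n /\ extendable theta u) ->
  (size s <= complexity (subshift theta) n)%N.
Proof.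
move=> us h; rewrite /complexity cardE -[leqRHS](size_map val).
apply: uniq_leq_size => // u /h[/eqP un /language_extendable ul].
apply/mapP; exists (Tuple un) => //.
by rewrite mem_enum inE; apply/asboolP.
Qed.

Lemma complexity_gt0 {A : finType} {theta : random_subst A} {l : nat}
    (hl : (2 <= l)%N) (htheta : constant_length theta l) (n : nat) :
  (0 < #|A|)%N -> (0 < complexity (subshift theta) n)%N.
Proof.
move=> /(extendable_size hl htheta n)[u un uext].
by apply: (complexity_ge _ _ [:: u]) => // v; rewrite inE => /eqP ->.
Qed.

(** Cutting after [m] letters is injective and leaves two extendable pieces; taking logarithms gives
    the subadditivity behind the entropy limit. *)
Lemma complexity_add {A : finType} (theta : random_subst A) (m n : nat) :
  (complexity (subshift theta) (m + n) <=
   complexity (subshift theta) m * complexity (subshift theta) n)%N.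
Proof.
pose S k := enum [set u : k.-tuple A | `[< language (subshift theta) u >]]%SET.
have memS k (u : seq A) : size u = k -> extendable theta u ->
    u \in [seq val t | t <- S k].
  move=> /eqP uk /language_extendable ul; apply/mapP; exists (Tuple uk) => //.
  by rewrite mem_enum inE; apply/asboolP.
have sS k : complexity (subshift theta) k = size [seq val t | t <- S k].
  by rewrite size_map -cardE.
rewrite [X in (_ <= X * _)%N]sS [X in (_ <= _ * X)%N]sS -(size_allpairs cat).
apply: complexity_le => u uk uext; apply/allpairsP.
exists (take m u, drop m u) => /=; split; last by rewrite cat_take_drop.
  apply: memS; first by rewrite size_takel// uk leq_addr.
  apply: extendable_infix uext.
  by apply/infixP; exists [::], (drop m u); rewrite /= cat_take_drop.
apply: memS; first by rewrite size_drop uk addKn.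
apply: extendable_infix uext.
by apply/infixP; exists (take m u), [::]; rewrite cats0 cat_take_drop.
Qed.

Lemma natr_size_substs_le {R : realType} {T : eqType} (f : T -> seq (seq T))
    (u : seq T) (E : R) :
  (forall a, a \in u -> (size (f a))%:R <= E) ->
  (size (substs f u))%:R <= E ^+ size u.
Proof.
move=> h; rewrite size_substs; elim: u h => [|a u IH] h; first by rewrite big_nil.
rewrite big_cons natrM exprS; apply: ler_pM => //; first by apply: h; rewrite mem_head.
by apply: IH => b bu; apply: h; rewrite inE bu orbT.
Qed.

(** A word of length [N * l ^ m] is determined by an ancestor of [N.+1] letters, a realisation of it
    and an offset below [l ^ m]. Letters of an extendable ancestor are extendable, so [E] bounds the
    choices at each of them. *)
Lemma complexity_powers_le {R : realType} {A : finType} {theta : random_subst A}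
    {l m : nat} (N : nat) (E : R)
    (hl : (2 <= l)%N) (htheta : constant_length theta l) :
  0 <= E ->
  (forall b, extendable theta [:: b] ->
    (size (powers (images theta) m b))%:R <= E) ->
  (complexity (subshift theta) (N * l ^ m))%:R <=
  (l ^ m)%:R * (#|A|%:R * E) ^+ N.+1.
Proof.
move=> E0 hE.
pose V := [seq t <- enum {: N.+1.-tuple A} | `[< extendable theta (val t) >]].
pose W := flatten [seq [seq take (N * l ^ m) (drop j y) |
  y <- substs (powers (images theta) m) (val t), j <- iota 0 (l ^ m)] | t <- V].
apply: (@le_trans _ _ (size W)%:R).
  rewrite ler_nat; apply: complexity_le => u uN uext.
  have [v [y [j [vN vext yv jl uE]]]] := extendable_desubst m N hl htheta _ uext uN.
  apply/flatten_mapP; have /eqP vN' := vN; exists (Tuple vN').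
    by rewrite mem_filter mem_enum andbT; apply/asboolP.
  by apply/allpairsP; exists (y, j); split=> //=; rewrite mem_iota.
have VT : (size V <= #|A| ^ N.+1)%N.
  by rewrite -card_tuple cardE size_filter count_size.
apply: (@le_trans _ _ ((size V)%:R * (E ^+ N.+1 * (l ^ m)%:R))).
  rewrite /W; have : {subset V <= [pred t | `[< extendable theta (val t) >]]}.
    by move=> t; rewrite mem_filter => /andP[].
  elim: V {W VT} => [|t V IH] hV /=; first by rewrite mul0r.
  rewrite size_cat natrD -natr1 mulrDl mul1r addrC lerD//.
    by apply: IH => t' tV; apply: hV; rewrite inE tV orbT.
  rewrite size_allpairs size_iota natrM ler_wpM2r// -[X in E ^+ X](size_tuple t).
  apply: natr_size_substs_le => a at_; apply: hE.
  by apply: extendable_letter at_; have /asboolP := hV t (mem_head _ _).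
rewrite exprMn mulrA mulrC ler_wpM2l// ler_wpM2r ?exprn_ge0//.
by rewrite -natrX ler_nat.
Qed.

(** * Fekete's lemma and the entropy limit *)

Lemma mulrn_bound_le {R : realType} (x y c : R) :
  (forall n : nat, n%:R * x <= n%:R * y + c) -> x <= y.
Proof.
move=> h; rewrite leNgt; apply/negP => yx.
have d0 : 0 < x - y by rewrite subr_gt0.
have := h (Num.bound `|c / (x - y)|).
set n := Num.bound _.
have : c / (x - y) < n%:R.
  by exact: le_lt_trans (ler_norm _) (archi_boundP (normr_ge0 _)).
rewrite ltr_pdivrMr//; nra.
Qed.

(** The limit is the infimum of [u n / n] over positive [n], whence the second conclusion. *)
Lemma fekete {R : realType} (u : nat -> R) :
  (forall n, 0 <= u n) -> (forall m n, u (m + n)%N <= u m + u n) ->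
  exists h : R, ((fun n => (n%:R^-1 * u n)%R) @ \oo --> h)%classic /\
    forall n, h * n%:R <= u n.
Proof.
move=> u0 uD.
pose S := [set n%:R^-1 * u n | n in [set n : nat | (0 < n)%N]]%classic.
have Slb : has_lbound S.
  by exists 0 => _ [n _ <-]; rewrite mulr_ge0 ?invr_ge0.
have Sinf : has_inf S by split=> //; exists (1%:R^-1 * u 1%N); exists 1%N.
have hle n : (0 < n)%N -> inf S <= n%:R^-1 * u n.
  by move=> n0; apply: ge_inf => //; exists n.
exists (inf S); split; last first.
  move=> [|n]; first by rewrite mulr0.
  by rewrite mulrC -ler_pdivlMl ?ltr0n// hle.
apply/cvgrPdist_le => e e0.
have e20 : 0 < e / 2 by rewrite divr_gt0.
have [_ [m m0 <-] hm] := inf_adherent e20 Sinf.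
(* As [u] is nonnegative, [C] bounds [u r] for every remainder [r] modulo [m], independently of
   [n]. *)
pose C := \sum_(r < m) u r.
have um q r : u (q * m + r)%N <= q%:R * u m + u r.
  elim: q => [|q IH]; first by rewrite mul0r add0r.
  rewrite mulSn -addnA; apply: le_trans (uD _ _) _.
  by rewrite -natr1 mulrDl mul1r; lra.
have uC n : u n <= (n %/ m)%:R * u m + C.
  rewrite {1}(divn_eq n m); apply: le_trans (um _ _) _; rewrite lerD2l /C.
  rewrite (bigD1 (Ordinal (ltn_pmod n m0)))//= lerDl sumr_ge0//.
near=> n.
have n0 : (0 < n)%N by near: n; exists 1%N.
have nR : 0 < n%:R :> R by rewrite ltr0n.
have mR : 0 < m%:R :> R by rewrite ltr0n.
have Cn : C <= e / 2 * n%:R.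
  rewrite -ler_pdivrMl//; near: n; exact: nbhs_infty_ger.
rewrite distrC ger0_norm ?subr_ge0 ?hle//.
rewrite lerBlDr ler_pdivrMl//.
apply: le_trans (uC n) _.
have qm : (n %/ m)%:R * m%:R <= n%:R :> R by rewrite -natrM ler_nat leq_divM.
have : (n %/ m)%:R * u m <= n%:R * (inf S + e / 2).
  rewrite -[u m](mulVKf (lt0r_neq0 mR)) mulrA.
  apply: (@le_trans _ _ (n%:R * (m%:R^-1 * u m))).
    by rewrite ler_wpM2r// mulr_ge0 ?invr_ge0.
  by rewrite ler_wpM2l// ltW.
nra.
Unshelve. all: by end_near.
Qed.

(** [htop] is a [limn], which is informative only once convergence is known. *)
Lemma htop_fekete {R : realType} {A : finType} {theta : random_subst A}
    {l : nat} (hA : (0 < #|A|)%N) (hl : (2 <= l)%N)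
    (htheta : constant_length theta l) :
  ((fun n : nat => (n%:R^-1 * ln (complexity (subshift theta) n)%:R : R)%R) @ \oo
    --> htop R (subshift theta))%classic /\
  forall n, htop R (subshift theta) * n%:R
    <= ln (complexity (subshift theta) n)%:R.
Proof.
have p0 n : 0 < (complexity (subshift theta) n)%:R :> R.
  by rewrite ltr0n (complexity_gt0 hl htheta).
have [n|m n|h [hc hle]] :=
    fekete (fun n => ln (complexity (subshift theta) n)%:R : R).
- by rewrite ln_ge0// ler1n (complexity_gt0 hl htheta).
- by rewrite -lnM ?posrE// ler_ln ?posrE ?mulr_gt0// -natrM ler_nat complexity_add.
- have -> : htop R (subshift theta) = h by apply: cvg_lim hc.
  by [].
Qed.

(** * Compactness and extraction of subsequences *)

(** Compactness gives a cluster point; an ultrafilter contains each set or its complement, so it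
    converges to that point. *)
Lemma ultra_compact_cvg {I : Type} {T : topologicalType} (G : set_system I)
    (K : set T) (f : I -> T) :
  UltraFilter G -> compact K -> (forall i, K (f i)) ->
  exists2 p, K p & (f @ G --> p)%classic.
Proof.
move=> GU Kc fK.
have [|p [Kp pcl]] := Kc (f @ G)%classic _.
- by rewrite nbhs_simpl /=; apply: filterE => i; apply: fK.
- exists p => // V pV; have [//|GnV] := in_ultra_setVsetC (f @^-1` V)%classic GU.
  have [q [nVq Vq]] := pcl (~` V)%classic V GnV pV.
  by case: nVq.
Qed.

(* The limits are taken along one ultrafilter finer than [\oo], which makes all
   coordinates converge at once. *)
Lemma joint_subsequence {R : realType} {A T : finType} (t : nat -> T)
    (x : nat -> A -> R) :
  (forall k a, 0 <= x k a <= 1) ->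
  exists (s : T) (eta : A -> R) (phi : nat -> nat),
    [/\ forall a, 0 <= eta a <= 1, forall j, (j <= phi j)%N /\ t (phi j) = s
      & forall a, ((x (phi j) a) @[j --> \oo] --> eta a)%classic].
Proof.
move=> x01; have [G [GU ooG]] := @ultraFilterLemma nat \oo%classic _.
have /choice[eta etaP] : forall a, exists p : R, 0 <= p <= 1 /\
    ((fun k => x k a) @ G --> p)%classic.
  move=> a.
  have [k|p] := ultra_compact_cvg G _ (fun k => x k a) GU (@segment_compact R 0 1).
    by rewrite /= in_itv /=.
  by rewrite /= in_itv /= => p01 Gp; exists p.
(* With finitely many values, one fibre of [t] belongs to [G]. For words, this fixes the starting
   letter along the subsequence. *)
have [s sP] : exists s, G [set k | t k = s]%classic.
  apply: contrapT => h.
  have : \forall k \near G, forall s, t k <> s.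
    apply: filter_forall => s.
    have [Gs|//] := in_ultra_setVsetC [set k | t k = s]%classic GU.
    by exfalso; apply: h; exists s.
  by move=> /filter_ex[k /(_ (t k))].
(* Asking for [j <= phi j] is enough to force divergence; [phi] need not be monotone. *)
have /choice[phi phiP] : forall j, exists k, [/\ (j <= k)%N, t k = s
    & forall a, `|eta a - x k a| <= j.+1%:R^-1].
  move=> j.
  have : \forall k \near G, [/\ (j <= k)%N, t k = s
    & forall a, `|eta a - x k a| <= j.+1%:R^-1].
    have h1 : \forall k \near G, (j <= k)%N by apply: ooG; exists j.
    have h2 : \forall k \near G, forall a, `|eta a - x k a| <= j.+1%:R^-1.
      apply: filter_forall => a; have [_ /cvgrPdist_le] := etaP a; apply.
      by rewrite invr_gt0.
    by apply: filterS3 h1 sP h2 => k.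
  by move=> /filter_ex.
exists s, eta, phi; split=> [a|j|a].
- by have [] := etaP a.
- by have [] := phiP j.
apply/cvgrPdist_le => e e0; near=> j.
have [_ _ /(_ a) h] := phiP j; apply: le_trans h _.
by apply/ltW; near: j; exact: (near_infty_natSinv_lt (PosNum e0)).
Unshelve. all: by end_near.
Qed.

(** * Weights of words and their maxima *)

(** The logarithm of the number of ways to substitute [v] once. *)
Definition weight {R : realType} {A : finType} (theta : random_subst A)
  (v : seq A) : R := \sum_(x <- v) ln (#|` theta x|%:R).

Lemma card_realisations_gt0 {A : finType} (theta : random_subst A) (a : A) :
  (0 < #|` theta a|)%N.
Proof. by rewrite cardfs_gt0 realisations_neq0. Qed.

Lemma weight_count {R : realType} {A : finType} (theta : random_subst A) v :
  weight theta v =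
  \sum_(a : A) (count_mem a v)%:R * ln (#|` theta a|%:R) :> R.
Proof.
rewrite /weight; elim: v => [|x v IH].
  by rewrite big_nil big1// => a _; rewrite mul0r.
rewrite big_cons IH /= [in RHS](bigD1 x)//= [in LHS](bigD1 x)//= eqxx.
rewrite natrD mulrDl mul1r addrA; congr (_ + _).
by apply: eq_bigr => a /negbTE ax; rewrite eq_sym ax.
Qed.

Lemma size_substs_images {R : realType} {A : finType} (theta : random_subst A) v :
  (size (substs (images theta) v))%:R = expR (weight theta v) :> R.
Proof.
rewrite size_substs /weight; elim: v => [|a v IH].
  by rewrite !big_nil expR0.
by rewrite !big_cons natrM IH expRD lnK// posrE ltr0n card_realisations_gt0.
Qed.

Lemma weight_substs_le {R : realType} {A : finType} (theta : random_subst A)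
    (f : A -> seq (seq A)) (z v : seq A) (C : R) :
  (forall a w, a \in z -> w \in f a -> weight theta w <= C) ->
  v \in substs f z -> weight theta v <= (size z)%:R * C.
Proof.
elim: z v => [|a z IH] v h.
  by rewrite inE => /eqP ->; rewrite /weight big_nil mul0r.
move=> /substs_consP[w [r [wa rz ->]]].
rewrite /weight big_cat /= -natr1 mulrDl mul1r addrC lerD//.
  by apply: IH rz => b w' bz; apply: h; rewrite inE bz orbT.
by apply: h wa; rewrite mem_head.
Qed.

Lemma seq_argmax {R : realType} {T : eqType} (F : T -> R) (s : seq T) (x0 : T) :
  x0 \in s -> exists2 x, x \in s & forall y, y \in s -> F y <= F x.
Proof.
elim: s x0 => // a [|b s] IH x0 _.
  by exists a; rewrite ?mem_head// => y; rewrite inE => /eqP ->.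
have [x xs xmax] := IH b (mem_head _ _).
have [ax|/ltW xa] := leP (F a) (F x).
  exists x; first by rewrite inE xs orbT.
  by move=> y; rewrite inE => /orP[/eqP ->|/xmax].
exists a; first exact: mem_head.
move=> y; rewrite inE => /orP[/eqP ->//|/xmax yx]; exact: le_trans yx xa.
Qed.

(** The maximum runs over a finite nonempty list of pairs. Starting letters are restricted to
    extendable ones, those from which a permissible vector may be built. *)
Lemma heaviest_word {R : realType} {A : finType} {theta : random_subst A}
    {l : nat} (hA : (0 < #|A|)%N) (hl : (2 <= l)%N)
    (htheta : constant_length theta l) (k : nat) :
  exists p : A * seq A, [/\ extendable theta [:: p.1],
    p.2 \in powers (images theta) k p.1
    & forall b v, extendable theta [:: b] -> v \in powers (images theta) k b ->
        weight theta v <= weight theta p.2 :> R].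
Proof.
pose s := [seq (b, v) | b <- [seq b <- enum A | `[< extendable theta [:: b] >]],
                        v <- powers (images theta) k b].
have sP b v : ((b, v) \in s) =
    `[< extendable theta [:: b] >] && (v \in powers (images theta) k b).
  apply/allpairsPdep/andP => [[b' [v' [+ vb [-> ->]]]]|[bext vb]].
    by rewrite mem_filter => /andP[].
  by exists b, v; rewrite mem_filter bext mem_enum.
have [[|b [|? ?]]// _ bext] := extendable_size hl htheta 1 hA.
have [v vb] := powers_neq0 _ k b (images_neq0 theta).
have [|[b' v'] + h] := seq_argmax (fun p => weight theta p.2 : R) s (b, v).
  by rewrite sP vb andbT; apply/asboolP.
rewrite sP => /andP[/asboolP b'ext vb']; exists (b', v'); split=> // c w cext wc.
by apply: (h (c, w)); rewrite sP wc andbT; apply/asboolP.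
Qed.

Lemma extendable_powers {A : finType} {theta : random_subst A} {l k : nat}
    (hl : (2 <= l)%N) (htheta : constant_length theta l) (b : A) (v : seq A) :
  extendable theta [:: b] -> v \in powers (images theta) k b ->
  extendable theta v.
Proof.
move=> bext vb; apply: (extendable_substs (m := k) hl htheta _ _ bext).
by rewrite substs_letter.
Qed.

(** * Upper estimates by maximal weights *)

(** Passing from level [m] to [m.+1] replaces each word [v] by [expR (weight theta v)] words, at
    most [expR (W m)]. *)
Lemma ln_size_powers_le {R : realType} {A : finType} {theta : random_subst A}
    {l : nat} (hl : (2 <= l)%N) (htheta : constant_length theta l)
    (W : nat -> R) (m : nat) (b : A) :
  (forall k b v, extendable theta [:: b] -> v \in powers (images theta) k b ->
    weight theta v <= W k) ->
  extendable theta [:: b] ->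
  (size (powers (images theta) m b))%:R <= expR (\sum_(k < m) W k).
Proof.
move=> hW bext; elim: m => [|m IH]; first by rewrite big_ord0 expR0.
rewrite big_ord_recr /= expRD.
apply: (@le_trans _ _ ((size (powers (images theta) m b))%:R * expR (W m))).
  have : forall v, v \in powers (images theta) m b -> weight theta v <= W m.
    by move=> v; apply: hW.
  elim: (powers _ m b) => [|v s IHs] h; first by rewrite mul0r.
  rewrite /= size_cat natrD -natr1 mulrDl mul1r addrC lerD//.
    by apply: IHs => w ws; apply: h; rewrite inE ws orbT.
  by rewrite size_substs_images ler_expR h// mem_head.
by rewrite ler_wpM2r// expR_ge0.
Qed.

(** In the count at length [N * l ^ m], the offset and the additional ancestor letter contribute a
    constant independent of [N], which disappears as [N] grows. *)
Lemma htop_powers_le {R : realType} {A : finType} {theta : random_subst A}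
    {l : nat} (hA : (0 < #|A|)%N) (hl : (2 <= l)%N)
    (htheta : constant_length theta l) (W : nat -> R) (m : nat) :
  (forall k b v, extendable theta [:: b] -> v \in powers (images theta) k b ->
    weight theta v <= W k) ->
  htop R (subshift theta) * (l ^ m)%:R <= ln #|A|%:R + \sum_(k < m) W k.
Proof.
move=> hW; have lm : (0 < l ^ m)%N by rewrite expn_gt0; lia.
pose E := expR (\sum_(k < m) W k) : R.
have AE : 0 < #|A|%:R * E by rewrite mulr_gt0 ?ltr0n ?expR_gt0.
rewrite -[X in _ + X](expRK (\sum_(k < m) W k)) -lnM ?posrE ?ltr0n ?expR_gt0//.
apply: (@mulrn_bound_le _ _ _ (ln (l ^ m)%:R + ln (#|A|%:R * E))) => N.
have [_ /(_ (N * l ^ m)%N) h] := @htop_fekete R _ _ _ hA hl htheta.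
rewrite mulrCA -natrM; apply: le_trans h _.
rewrite addrCA mulr_natl -mulrSr -lnXn// -lnM ?posrE ?ltr0n ?exprn_gt0//.
rewrite ler_ln ?posrE ?mulr_gt0 ?ltr0n ?exprn_gt0 ?(complexity_gt0 hl htheta)//.
apply: (complexity_powers_le _ _ hl htheta); first exact: expR_ge0.
by move=> b; apply: (ln_size_powers_le hl htheta).
Qed.

(** Past the index [K], the sum is dominated by a geometric one of size at most
    [Q * l ^ m / (l - 1)]; the first [K] terms are a constant, negligible against [l ^ m]. *)
Lemma geometric_sum_growth {R : realType} (l : nat) (W : nat -> R) (h c Q : R) :
  (2 <= l)%N -> 0 <= Q ->
  (forall m, h * (l ^ m)%:R <= c + \sum_(k < m) W k) ->
  (\forall k \near \oo%classic, W k <= Q * (l ^ k)%:R) ->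
  h <= (l%:R - 1)^-1 * Q.
Proof.
move=> hl Q0 hW [K _ WK].
have l1 : 0 < l%:R - 1 :> R by rewrite subr_gt0 ltr1n.
have sumW d : \sum_(k < K + d) W k <=
    \sum_(k < K) W k + (l%:R - 1)^-1 * Q * (l ^ (K + d))%:R.
  elim: d => [|d IH].
    by rewrite addn0 lerDl !mulr_ge0// invr_ge0 ltW.
  rewrite addnS big_ord_recr /=; apply: (le_trans (lerD IH (WK _ (leq_addr _ _)))).
  rewrite -addrA lerD2l expnS natrM le_eqVlt; apply/orP; left; apply/eqP.
  by field; rewrite lt0r_neq0.
apply: (@mulrn_bound_le _ _ _ `|c + \sum_(k < K) W k|) => n.
rewrite -lerBlDl -mulrBr.
have [d0|/ltW d0] := leP (h - (l%:R - 1)^-1 * Q) 0.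
  by apply: le_trans (normr_ge0 _); rewrite mulr_ge0_le0.
(* For a nonnegative gap, [n <= l ^ (K + n)] turns exponential growth into the linear bound
   needed. *)
apply: (@le_trans _ _ ((h - (l%:R - 1)^-1 * Q) * (l ^ (K + n))%:R)).
  rewrite mulrC ler_wpM2l// ler_nat; apply: leq_trans (leq_addl K n) _.
  by apply/ltnW/ltn_expl.
apply: le_trans (ler_norm _); rewrite mulrBl lerBlDr.
by apply: le_trans (hW _) _; rewrite -addrA lerD2l.
Qed.

(** * Letter frequencies and the two entropy bounds *)

(** Weight per letter is a finite linear combination of the letter frequencies. *)
Lemma weight_frequency {R : realType} {A : finType} (theta : random_subst A)
    (v : nat -> seq A) (nu : A -> R) :
  (forall a, (((count_mem a (v k))%:R / (size (v k))%:R : R)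
     @[k --> \oo] --> nu a)%classic) ->
  ((weight theta (v k) / (size (v k))%:R : R) @[k --> \oo]
    --> \sum_(a : A) nu a * ln (#|` theta a|%:R))%classic.
Proof.
move=> hnu; under eq_fun do rewrite weight_count mulr_suml.
apply: cvg_big; first exact: add_continuous.
move=> a _; under eq_fun do rewrite mulrAC.
by apply: cvgM; [exact: hnu|exact: cvg_cst].
Qed.

Lemma htop_ge_frequency {R : realType} {A : finType} {theta : random_subst A}
    {l : nat} (hA : (0 < #|A|)%N) (hl : (2 <= l)%N)
    (htheta : constant_length theta l) (nu : A -> R) :
  permissible theta nu ->
  l%:R^-1 * (\sum_(a : A) nu a * ln (#|` theta a|%:R))
    <= htop R (subshift theta).
Proof.
move=> [_ [b [n [v [/language_extendable bext [_ noo] vb hnu]]]]].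
have fl := constant_lengthE htheta.
have {}vb k : v k \in powers (images theta) (n k) b by apply/subst_powE.
have sv k : size (v k) = (l ^ n k)%N := size_powers_word _ _ fl _ _ _ (vb k).
(* The words counted are images of [v k], one level further: this additional factor [l] in their
   length is the source of [1 / l]. *)
have Noo : ((l ^ (n k).+1)%N @[k --> \oo] --> \oo)%classic.
  apply/cvgnyPge => M; have /cvgnyPge/(_ M) := noo; apply: filterS => k Mk.
  by apply: leq_trans Mk _; apply/ltnW/ltnW/ltn_expl.
have [hlim _] := @htop_fekete R _ _ _ hA hl htheta.
have lv : ((l%:R^-1 * (weight theta (v k) / (size (v k))%:R) : R) @[k --> \oo]
    --> l%:R^-1 * \sum_(a : A) nu a * ln (#|` theta a|%:R))%classic.
  by apply: cvgM; [exact: cvg_cst|exact: weight_frequency].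
have hN := cvg_comp _ _ Noo hlim.
apply: (ler_cvg_to lv hN).
near=> k => /=.
rewrite sv mulrCA -invfM -natrM -expnS mulrC ler_wpM2l ?invr_ge0//.
rewrite -ler_expR -size_substs_images lnK ?posrE ?ltr0n ?(complexity_gt0 hl htheta)//.
rewrite ler_nat; apply: complexity_ge.
  by apply: uniq_substs fl _ _ => a; apply: fset_uniq.
move=> u uv; split; first by rewrite (size_substs_word _ _ fl _ _ uv) sv expnSr.
have : u \in powers (images theta) (n k).+1 b by apply/powersSP; exists (v k).
exact: (extendable_powers hl htheta).
Unshelve. all: by end_near.
Qed.

Lemma htop_le_frequency {R : realType} {A : finType} {theta : random_subst A}
    {l : nat} (hA : (0 < #|A|)%N) (hl : (2 <= l)%N)
    (htheta : constant_length theta l) :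
  exists eta : A -> R, permissible theta eta /\
    htop R (subshift theta)
      <= (l%:R - 1)^-1 * (\sum_(a : A) eta a * ln (#|` theta a|%:R)).
Proof.
have fl := constant_lengthE htheta.
have l0 : (0 < l)%N by lia.
have /choice[p pP] := @heaviest_word R _ _ _ hA hl htheta.
pose W k : R := weight theta (p k).2; pose q k : R := W k / (l ^ k)%:R.
have lk k : 0 < (l ^ k)%:R :> R by rewrite ltr0n expn_gt0 l0.
have hW k b v : extendable theta [:: b] -> v \in powers (images theta) k b ->
    weight theta v <= W k by have [_ _] := pP k; apply.
(* Splitting off the first step, a word of level [k.+1] is a concatenation of [l] words of level [k]
   with extendable starting letters, so [W k.+1 <= l * W k]. *)
have q_dec : {homo q : j k / (j <= k)%N >-> k <= j}.
  apply/nonincreasing_seqP => k.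
  rewrite /q ler_pdivrMr// expnS natrM mulrCA divfK ?lt0r_neq0//.
  have [bext pb _] := pP k.+1.
  have /powers_addP[z zb vz] :
    (p k.+1).2 \in powers (images theta) (k + 1) (p k.+1).1 by rewrite addn1.
  have -> : l = size z by rewrite (size_powers_word _ _ fl _ _ _ zb) expn1.
  apply: weight_substs_le vz => a w az; apply: (hW k a).
  exact: (extendable_letter _ _ _ (extendable_powers hl htheta _ _ bext zb) az).
pose x k a : R := (count_mem a (p k).2)%:R / (size (p k).2)%:R.
have sp k : size (p k).2 = (l ^ k)%N.
  by have [_ pb _] := pP k; apply: size_powers_word fl _ _ _ pb.
have x01 k a : 0 <= x k a <= 1.
  rewrite /x divr_ge0//= sp ler_pdivrMr// mul1r -sp ler_nat.
  exact: count_size.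
have [b [eta [phi [eta01 phiP xeta]]]] := joint_subsequence (fun k => (p k).1) x x01.
have phioo : (phi j @[j --> \oo] --> \oo)%classic.
  apply/cvgnyPge => M; near=> j; have [+ _] := phiP j; apply: leq_trans.
  by near: j; exists M.
set Q := \sum_(a : A) eta a * ln (#|` theta a|%:R).
have qQ : (q (phi j) @[j --> \oo] --> Q)%classic.
  have := weight_frequency theta (fun j => (p (phi j)).2) eta xeta.
  by under eq_fun do rewrite sp.
have Q0 : 0 <= Q.
  apply: sumr_ge0 => a _; have /andP[? _] := eta01 a.
  by rewrite mulr_ge0// ln_ge0// ler1n card_realisations_gt0.
exists eta; split.
  (* The shift by one ensures positive levels, since [phi 0] may vanish. *)
  split=> //; exists b, (fun j => phi j.+1), (fun j => (p (phi j.+1)).2); split.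
  - by apply/language_extendable; have [_ <-] := phiP 0%N; have [] := pP (phi 0%N).
  - split=> [j|]; first by have [+ _] := phiP j.+1; apply: leq_trans.
    by rewrite (cvg_shiftS phi).
  - by move=> j; apply/subst_powE; have [_ <-] := phiP j.+1; have [] := pP (phi j.+1).
  - by move=> a; rewrite (cvg_shiftS (fun j => x (phi j) a)); apply: xeta.
have l1 : 0 < l%:R - 1 :> R by rewrite subr_gt0 ltr1n.
apply/ler_addgt0Pr => e e0.
(* The slack is scaled so that dividing by [l - 1] leaves exactly [e]. *)
have e' : 0 < e * (l%:R - 1) by rewrite mulr_gt0.
have -> : (l%:R - 1)^-1 * Q + e = (l%:R - 1)^-1 * (Q + e * (l%:R - 1)).
  by field; rewrite lt0r_neq0.
apply: (geometric_sum_growth l W _ (ln #|A|%:R)) => //.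
- by rewrite addr_ge0// ltW.
- by move=> m; apply: htop_powers_le hA hl htheta _ _ hW.
have /cvgrPdist_le/(_ _ e')[J _ /(_ J (leqnn _))/= hJ] := qQ.
(* Monotonicity of [q] extends the estimate from the single index [phi J] to all later levels. *)
exists (phi J) => // k /= Jk.
rewrite -ler_pdivrMr//; apply: le_trans (q_dec _ _ Jk) _.
by move: hJ; rewrite ler_norml => /andP[]; lra.
Unshelve. all: by end_near.
Qed.

Theorem proposition4p6 (R : realType) (A : finType) (theta : random_subst A)
    (l : nat) (hA : (0 < #|A|)%N) (hl : (2 <= l)%N)
    (htheta : constant_length theta l) :
  [/\ forall nu : A -> R, permissible theta nu ->
        l%:R^-1 * (\sum_(a : A) nu a * ln (#|` theta a|%:R))
          <= htop R (subshift theta),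
      exists eta : A -> R, permissible theta eta /\
        htop R (subshift theta)
          <= (l%:R - 1)^-1 * (\sum_(a : A) eta a * ln (#|` theta a|%:R))
    & forall eta : A -> R, permissible theta eta ->
        (forall nu : A -> R, permissible theta nu ->
           \sum_(a : A) nu a * ln (#|` theta a|%:R)
             <= \sum_(a : A) eta a * ln (#|` theta a|%:R)) ->
        htop R (subshift theta)
          <= (l%:R - 1)^-1 * (\sum_(a : A) eta a * ln (#|` theta a|%:R))].
Proof.
have [eta [etaP h]] := @htop_le_frequency R _ _ _ hA hl htheta.
split; first by move=> nu; apply: htop_ge_frequency.
  by exists eta.
(* By maximality, the sum for [eta'] dominates the one for the vector [eta] already found. *)
move=> eta' _ eta'max; apply: le_trans h _.
by rewrite ler_wpM2l ?eta'max// invr_ge0 subr_ge0 ler1n ltnW.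
Qed.
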